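(* Let $G$ be a finite group. If $\delta_{\mathcal{CD}}(G) <5$, then one of the following holds: \begin{enumerate} \item $\delta_{\mathcal{CD}}(G) < 3$; \item $\delta_{\mathcal{CD}}(G) = 3$ and $G$ is cyclic of order either $p\cdot q$ or $p^3$ for primes $p, q$; \item $\delta_{\mathcal{CD}}(G) = 4$ and $G$ is isomorphic to either a cyclic group of order $p^4$ for a prime $p$, or $C_2\times C_2$, or the extraspecial group of order $27$ and exponent $9$. \end{enumerate}
   Context: For a finite group $G$ and a subgroup $H\leq G$, the Chermak--Delgado measure of $H$ is $m_G(H)=|H|\cdot|\mathbf{C}_G(H)|$, where $\mathbf{C}_G(H)$ is the centralizer of $H$ in $G$. Let $m^*(G)=\max_{H\leq G} m_G(H)$. The Chermak--Delgado lattice of $G$ is $\mathcal{CD}(G)=\{H\leq G : m_G(H)=m^*(G)\}$. Write $\delta_{\mathcal{CD}}(G)$ for the number of subgroups of $G$ that are not in $\mathcal{CD}(G)$. $C_n$ denotes the cyclic group of order $n$. The extraspecial group of order $27$ and exponent $9$ is $\langle a,b \mid a^{9}=b^{3}=1,\ b^{-1}ab=a^{4}\rangle$. *)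

(* Defs.v *)
From mathcomp Require Import all_boot all_fingroup all_solvable.

Set Implicit Arguments.
Unset Strict Implicit.
Unset Printing Implicit Defensive.

Definition cd_measure (gT : finGroupType) (G H : {group gT}) : nat :=
  #|H| * #|'C_G(H)%g|.

Definition max_cd_measure (gT : finGroupType) (G : {group gT}) : nat :=
  \max_(H in subgroups G) cd_measure G H.

Definition cd_lattice (gT : finGroupType) (G : {group gT}) :
    {set {group gT}} :=
  [set H in subgroups G | cd_measure G H == max_cd_measure G].

Definition delta_cd (gT : finGroupType) (G : {group gT}) : nat :=
  #|subgroups G :\: cd_lattice G|.

(* In MathComp [x ^ y] is [y^-1 * x * y], and a relator without a right-hand
   side is set equal to 1. *)
Definition is_extraspecial_27_exp_9 (gT : finGroupType) (G : {group gT}) :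
    Prop :=
  (G \isog Grp (a : b : a ^+ 9, b ^+ 3, a ^ b = a ^+ 4))%g.

(* Main.v *)
Require Import Defs.
From mathcomp Require Import all_boot all_algebra all_fingroup all_solvable.
From mathcomp Require Import zify.

(* Members of the Chermak-Delgado lattice contain the center, permute with their
   conjugates, and, unless equal to G, are proper subgroups of their normalisers.
   If G is not nilpotent, then some Sylow subgroup P is not normal and none of its conjugates
   is in the lattice; fewer than five exceptions force |G : P| to be 3 or 4 and
   leave no room for both 1 and another subgroup. If G is nilpotent but neither
   cyclic nor a p-group, then all subgroups of a noncyclic Sylow subgroup miss
   part of the center.
   Let G be a nonabelian p-group. If it has only one subgroup of order p, it is
   generalized quaternion. Otherwise five exceptions are avoided only if the
   center Z has order p, the subgroups of order p generate E of order p^2, and at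
   most one subgroup outside the lattice is not in S, the set of 1 and the p
   noncentral subgroups of order p; such a subgroup is then normal, so that every
   subgroup not in S contains Z. Hence, for A in S of order p and N = C(A), the
   quotient N / A has only one subgroup of order p. If N / A is cyclic, then
   |N|^2 <= m*(G) = p |G| = p^2 |N| forces |G| = p^3. For p = 2 the square of an
   element outside N always lies in E, and this produces an involution outside
   E. *)

Section ChermakDelgado.

Set Implicit Arguments.
Unset Strict Implicit.
Unset Printing Implicit Defensive.

Local Open Scope group_scope.

(** A noncyclic group is not the union of two cyclic subgroups. Hence there are [u] different from
    1, [x] outside [<[u]>], and [y] outside both [<[u]>] and [<[x]>], and their cyclic subgroups
    differ from each other, from 1 and from [G]. *)
Lemma five_le_subgroups (gT : finGroupType) (G : {group gT}) :
  ~~ cyclic G -> 5 <= #|subgroups G|.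
Proof.
move=> ncG.
have notcyc y : y \in G -> exists2 z, z \in G & z \notin <[y]>.
  move=> Gy; apply/subsetPn; apply: contra ncG => sGy.
  by apply/cyclicP; exists y; apply/eqP; rewrite eqEsubset sGy cycle_subG.
have [u Gu u1] := notcyc 1 (group1 G).
have [x Gx xu] := notcyc u Gu.
have [y Gy /andP[yu yx]] : exists2 y, y \in G & (y \notin <[u]>) && (y \notin <[x]>).
  (* If [<[x]>] contains [<[u]>], it is enough to avoid [<[x]>]; otherwise neither contains the
     other generator, and [u * x] avoids both. *)
  have [ux | ux] := boolP (u \in <[x]>).
    have [y Gy yx] := notcyc x Gx; exists y => //; rewrite yx andbT.
    by apply: contra yx; apply: subsetP; rewrite cycle_subG.
  exists (u * x); first exact: groupM.
  by rewrite groupMl ?cycle_id // xu groupMr ?cycle_id.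
have nt z w : z \notin <[w : gT]> -> 1%G != <[z]>%G.
  by apply: contraNneq => /(congr1 val)/= /esym/eqP; rewrite cycle_eq1 => /eqP->.
have nG z : G != <[z]>%G.
  by apply: contraNneq ncG => ->; apply: cycle_cyclic.
have neq z w : z \notin <[w : gT]> -> <[w]>%G != <[z]>%G.
  by apply: contraNneq => /(congr1 val)/= ->; apply: cycle_id.
pose s : seq {group gT} := [:: 1%G; G; <[u]>%G; <[x]>%G; <[y]>%G].
have us : uniq s.
  rewrite /= !inE !negb_or !nG (nt _ _ u1) (nt _ _ xu) (nt _ _ yu).
  rewrite (neq _ _ xu) (neq _ _ yu) (neq _ _ yx) !andbT.
  by apply: contraNneq ncG => <-; apply: cyclic1.
rewrite -[5]/(size s) -(card_uniqP us); apply/subset_leq_card/subsetP => H.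
by rewrite !inE => /or4P[/eqP->|/eqP->|/eqP->|/orP[]/eqP->];
  rewrite ?sub1G ?subxx ?cycle_subG.
Qed.

(** * Closure properties of the Chermak-Delgado lattice *)

Section Lattice.

Variables (gT : finGroupType) (G : {group gT}).
Implicit Types H K : {group gT}.

Local Notation m := (cd_measure G).
Local Notation mstar := (max_cd_measure G).
Local Notation CD := (cd_lattice G).

Lemma cd_measure_le_max H : H \subset G -> m H <= mstar.
Proof. by move=> sHG; apply: leq_bigmax_cond; rewrite inE. Qed.

Lemma cd_latticeE H : (H \in CD) = (H \subset G) && (m H == mstar).
Proof. by rewrite !inE. Qed.

Lemma cd_lattice_sub H : H \in CD -> H \subset G.
Proof. by rewrite cd_latticeE => /andP[]. Qed.

Lemma cd_lattice_measure H : H \in CD -> m H = mstar.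
Proof. by rewrite cd_latticeE => /andP[_ /eqP]. Qed.

Lemma notin_cd_lattice H K : K \subset G -> m H < m K -> H \notin CD.
Proof.
move=> sKG ltHK; rewrite cd_latticeE negb_and neq_ltn orbC.
by rewrite (leq_trans ltHK (cd_measure_le_max sKG)).
Qed.

Lemma cd_latticeJ H x : x \in G -> ((H :^ x)%G \in CD) = (H \in CD).
Proof.
move=> Gx; rewrite !cd_latticeE /= -{1}(conjGid Gx) conjSg; congr (_ && (_ == _)).
by rewrite /cd_measure /= centJ -{1}(conjGid Gx) -conjIg !cardJg.
Qed.

(** The product of the measures of [H] and [K] is [#|H * K| * #|'C_G(H <*> K)|] times
    [#|H :&: K| * #|'C_G(H) * 'C_G(K)|]. These factors are bounded by the measures of the join and
    of the intersection, hence by [mstar], so equality holds and [H * K] fills the join. *)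
Lemma cd_lattice_mul H K : H \in CD -> K \in CD ->
  H * K = H <*> K /\ (H <*> K)%G \in CD.
Proof.
move=> cdH cdK.
have [sHG sKG] := (cd_lattice_sub cdH, cd_lattice_sub cdK).
have sHKG : H <*> K \subset G by rewrite join_subG sHG.
have sIG : H :&: K \subset G by rewrite subIset ?sHG.
have leJ := cd_measure_le_max sHKG; have leI := cd_measure_le_max sIG.
have sMJ := mul_subG (joing_subl H K) (joing_subr H K).
have leM := subset_leq_card sMJ.
have cardM := mul_cardG H K.
have cardC := mul_cardG 'C_G(H) 'C_G(K).
have cJ : 'C_G(H) :&: 'C_G(K) = 'C_G(H <*> K) by rewrite centY -setIIr.
have sC : 'C_G(H) * 'C_G(K) \subset 'C_G(H :&: K).
  by rewrite mul_subG // setIS // centS ?subsetIl ?subsetIr.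
have leC := subset_leq_card sC; rewrite cJ in cardC.
move: (cd_lattice_measure cdH) (cd_lattice_measure cdK) leJ leI.
rewrite cd_latticeE sHKG /= /cd_measure /= => eH eK leJ leI.
have posH := cardG_gt0 H; have posI := cardG_gt0 (H :&: K)%G.
have posCH := cardG_gt0 'C_G(H)%G; have posCJ := cardG_gt0 'C_G(H <*> K)%G.
have posM : 0 < #|H * K| by rewrite (leq_trans posH) ?subset_leq_card ?mulG_subl.
have posCM : 0 < #|'C_G(H) * 'C_G(K)|.
  by rewrite (leq_trans posCH) ?subset_leq_card ?mulG_subl.
have pos : 0 < mstar by rewrite -eH muln_gt0 posH.
rewrite /= in posI posCH posCJ.
have E : (mstar * mstar = (#|(H * K)%g| * #|'C_G(H <*> K)|) *
   (#|H :&: K| * #|('C_G(H) * 'C_G(K))%g|))%N.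
  by rewrite -{1}eH -eK mulnACA cardM [(#|'C_G(H)| * _)%N]cardC [X in (_ * X)%N = _]mulnC mulnACA.
have B1 : (#|(H * K)%g| * #|'C_G(H <*> K)| <= #|H <*> K| * #|'C_G(H <*> K)|)%N.
  by rewrite leq_mul2r leM orbT.
have B2 : (#|H :&: K| * #|('C_G(H) * 'C_G(K))%g| <= mstar)%N.
  by apply: leq_trans leI; rewrite leq_mul2l leC orbT.
have E1 : (#|(H * K)%g| * #|'C_G(H <*> K)| = mstar)%N.
  apply/eqP; rewrite eqn_leq (leq_trans B1 leJ) /= -(leq_pmul2r pos) E.
  by rewrite leq_mul2l B2 orbT.
have E2 : (#|H <*> K| * #|'C_G(H <*> K)| = mstar)%N.
  by apply/eqP; rewrite eqn_leq leJ -E1 B1.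
split; last by rewrite E2.
apply/eqP; rewrite eqEcard sMJ /=.
by rewrite -(leq_pmul2r posCJ) E1 E2.
Qed.

Lemma cent_joing_center H : 'C_G(H <*> 'Z(G)) = 'C_G(H).
Proof.
apply/setP=> x; rewrite centY !inE; case Gx: (x \in G) => //=.
case: (x \in 'C(H)) => //=; apply: subsetP Gx.
by rewrite centsC subsetIr.
Qed.

(** Joining the center to [H] leaves the centraliser unchanged, so it would increase a maximal
    measure unless [H] already contained the center. *)
Lemma cd_lattice_center H : H \in CD -> 'Z(G) \subset H.
Proof.
move=> cdH; have sHG := cd_lattice_sub cdH.
have sJG : H <*> 'Z(G) \subset G by rewrite join_subG sHG center_sub.
have := cd_measure_le_max sJG; rewrite -(cd_lattice_measure cdH) /cd_measure /=.
rewrite cent_joing_center leq_pmul2r ?cardG_gt0 // => le.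
have /eqP-> : H :==: H <*> 'Z(G) by rewrite eqEcard joing_subl.
exact: joing_subr.
Qed.

(* Above H, take K minimal among G and the members of the lattice: if a
   conjugate of H by an element of K differed from H, then the product of the
   two would be K, which is impossible. *)
Lemma cd_lattice_normaliser H : H \in CD -> 'N_G(H) = H -> H :=: G.
Proof.
move=> cdH nH; have sHG := cd_lattice_sub cdH.
apply/eqP; rewrite eqEsubset sHG /=; apply: contraT => nGH.
pose P (K : {group gT}) := (H \proper K) && ((K \in CD) || (K == G)).
have PG : P G by rewrite /P properE sHG nGH eqxx orbT.
have [K /mingroupP[/andP[pHK cdK] minK] _] := mingroup_exists PG.
have sKG : K \subset G.
  by case/orP: cdK => [/cd_lattice_sub|/eqP->].
have [sHK nKH] := andP pHK; case/negP: nKH.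
rewrite -nH subsetI sKG; apply/subsetP=> x Kx; have Gx := subsetP sKG x Kx.
have cdHx : (H :^ x)%G \in CD by rewrite cd_latticeJ.
have [eM cdM] := cd_lattice_mul cdH cdHx.
have sMK : H <*> (H :^ x) \subset K by rewrite join_subG sHK conj_subG.
rewrite inE; have [sMH | nMH] := boolP (H <*> (H :^ x) \subset H).
  exact: subset_trans (joing_subr _ _) sMH.
have eK : (H <*> (H :^ x))%G :=: K.
  by apply: minK => //; rewrite /P properE joing_subl nMH cdM.
have := Kx; rewrite -eK /= -eM => /mulsgP[h _ Hh /imsetP[k Hk ->] def_x].
(* Cancelling in [x = h * x^-1 * k * x] shows that [x] is a product of elements of [H], and so
   normalises [H]. *)
have {}def_x : x = k * h.
  apply: invg_inj; rewrite invMg; apply: (mulgI h); rewrite mulKVg.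
  by apply: (mulIg k); apply: (mulIg x); rewrite mulVg mul1g [RHS]def_x conjgE !mulgA.
by rewrite def_x; rewrite conjGid ?groupM.
Qed.

End Lattice.

(** * Nilpotent and non-nilpotent groups *)

Section Delta.

Variables (gT : finGroupType) (G : {group gT}).
Implicit Types H K P Q : {group gT}.

Local Notation CD := (cd_lattice G).

Lemma card_le_delta_cd (S : {set {group gT}}) :
  (forall H, H \in S -> H \subset G /\ H \notin CD) -> #|S| <= delta_cd G.
Proof.
move=> sS; apply/subset_leq_card/subsetP => H /sS[sHG cdH].
by rewrite !in_setD cdH inE.
Qed.

(** The product of [P] with a conjugate is again a group, hence a p-subgroup containing [P]; Sylow
    maximality makes the conjugate equal to [P]. *)
Lemma cd_lattice_Sylow p P : p.-Sylow(G) P -> P \in CD -> P <| G.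
Proof.
move=> sylP cdP; have [sPG pP _] := and3P sylP.
apply/andP; split=> //; apply/subsetP => x Gx; rewrite inE.
have cdPx : (P :^ x)%G \in CD by rewrite cd_latticeJ.
have [eM _] := cd_lattice_mul cdP cdPx.
have pPx : p.-group (P :^ x) by rewrite pgroupJ.
have pJ : p.-group (P <*> (P :^ x)) by rewrite -eM pgroupM pP.
have sJG : P <*> (P :^ x) \subset G.
  by rewrite join_subG sPG conj_subG.
have /= eJ := sub_pHall sylP pJ (joing_subl _ _) sJG.
by apply: subset_trans (joing_subr P _) _; rewrite eJ.
Qed.

Lemma nilpotent_Sylow_normal :
  (forall p P, prime p -> p.-Sylow(G) P -> P <| G) -> nilpotent G.
Proof.
move=> nS; suffices sGF : G \subset 'F(G) by apply: nilpotentS sGF (Fitting_nil G).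
rewrite -{1}(Sylow_gen G) gen_subG; apply/bigcupsP => P /SylowP[p p_pr sylP].
have nP := nS _ _ p_pr sylP.
by apply: Fitting_max => //; apply: pgroup_nil (pHall_pgroup sylP).
Qed.

Lemma delta_nilpotent_non_pgroup :
  nilpotent G -> ~~ cyclic G -> (forall p : nat, ~~ p.-group G) -> 5 <= delta_cd G.
Proof.
move=> nilG ncG npG.
have [P sylP ncP] : exists2 P : {group gT}, Sylow G P & ~~ cyclic P.
  have : ~~ Zgroup G by apply: contra ncG => /nil_Zgroup_cyclic->.
  by rewrite negb_forall => /existsP[P]; rewrite negb_imply => /andP[]; exists P.
have /SylowP[p p_pr {}sylP] := sylP; have [sPG pP _] := and3P sylP.
have defG := nilpotent_pcoreC p nilG.
have ntK : 'O_p^'(G) != 1.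
  apply: contraNneq (npG p) => K1; rewrite K1 dprodg1 in defG.
  by rewrite -defG pcore_pgroup.
have ntZ := meet_center_nil nilG (pcore_normal p^' G) ntK.
apply: leq_trans (five_le_subgroups ncP) _.
apply: card_le_delta_cd => H; rewrite inE => sHP.
split; first exact: subset_trans sHP sPG.
apply: contra ntZ => /cd_lattice_center sZH.
rewrite -subG1 -(coprime_TIg (pnat_coprime pP (pcore_pgroup p^' G))) setIC.
by apply: setIS; apply: subset_trans sZH sHP.
Qed.

(** For the last clause, suppose that [N = 'N_G(P)] is larger than [P]. It is self-normalising and
    proper, so neither it nor its conjugates are in the lattice. There are as many conjugates of [N]
    as Sylow p-subgroups, and at least three of each kind. *)
Lemma nonnormal_Sylow_card p P : prime p -> p.-Sylow(G) P -> ~~ (P <| G) ->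
  [/\ p < #|'Syl_p(G)|, (forall Q, Q \in 'Syl_p(G) -> Q \subset G /\ Q \notin CD)
    & 5 <= delta_cd G \/ 'N_G(P) = P /\ #|'Syl_p(G)| = #|G : P|].
Proof.
move=> p_pr sylP nnP; have [sPG pP _] := and3P sylP.
have badS Q : Q \in 'Syl_p(G) -> Q \subset G /\ Q \notin CD.
  rewrite inE => sylQ; split; first exact: pHall_sub sylQ.
  apply: contra nnP => /(cd_lattice_Sylow sylQ) nQ.
  by have [x Gx ->] := Sylow_trans sylQ sylP; rewrite (normP (subsetP (normal_norm nQ) x Gx)).
have oS := card_Syl sylP; have oSp := card_Syl_mod G p_pr.
have ltp : p < #|'Syl_p(G)|.
  have S1 : #|'Syl_p(G)| != 1%N.
    apply: contra nnP; rewrite oS indexg_eq1 => sGN.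
    by rewrite /normal sPG (subset_trans sGN) ?subsetIr.
  rewrite ltnNge; apply: contra S1 => le; move: oSp.
  have := le; rewrite leq_eqVlt => /predU1P[-> | lt]; first by rewrite modnn.
  by rewrite modn_small // => ->.
split=> //; have [nP | nnN] := eqVneq 'N_G(P) (P : {set gT}).
  by right; rewrite oS nP.
left; pose N := 'N_G(P)%G; have sNG : N \subset G by apply: subsetIl.
have sPN : P \subset N by rewrite subsetI sPG normG.
have nNP : P <| N by rewrite /normal sPN subsetIr.
have sylPN : p.-Sylow(N) P := pHall_subl sPN sNG sylP.
have chP : P \char N.
  by have := pcore_char p N; rewrite (normal_Hall_pcore sylPN nNP).
have nN : 'N_G(N) = N.
  apply/eqP; rewrite eqEsubset subsetI sNG normG andbT /= subsetI subsetIl /=.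
  rewrite andbT; apply: (subset_trans (subsetIr G _)); exact: char_norms.
have cN x : x \in G -> (N :^ x)%G \notin CD.
  move=> Gx; rewrite cd_latticeJ //.
  apply: contra nnP => cdN; rewrite /normal sPG.
  by rewrite -(cd_lattice_normaliser cdN nN) subsetIr.
pose S := orbit 'JG G N.
have oSN : #|S| = #|G : N|.
  by rewrite card_orbit astab1JG nN.
have disj : [disjoint 'Syl_p(G) & S].
  rewrite disjoint_subset; apply/subsetP => Q; rewrite !inE => sylQ.
  apply: contra nnN => /orbitP[x Gx defQ].
  have := card_Hall sylQ; rewrite -defQ /= cardJg -(card_Hall sylP) => eqN.
  by rewrite eq_sym eqEcard subsetI sPG normG eqN /=.
have := card_le_delta_cd (S := 'Syl_p(G) :|: S).
rewrite cardsU disjoint_setI0 // cards0 subn0 oSN /= -oS => le.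
have {}le : #|'Syl_p(G)| + #|'Syl_p(G)| <= delta_cd G.
  apply: le => H /setUP[/badS // | /orbitP[x Gx <-]].
  by split; [apply: (conj_subG Gx) | apply: (cN x Gx)].
have lt2 : 2 < #|'Syl_p(G)| := leq_ltn_trans (prime_gt1 p_pr) ltp.
exact: leq_trans (leq_trans (leq_add lt2 lt2) le).
Qed.
End Delta.

Section NonNilpotent.

Variables (gT : finGroupType) (G : {group gT}).
Implicit Types H K P Q : {group gT}.

Local Notation CD := (cd_lattice G).

(** The two families of Sylow subgroups are disjoint, since a common member would be trivial and
    hence normal; they contribute at least p + 1 and q + 1 exceptions. *)
Lemma delta_Sylow_pair p q P Q : prime p -> prime q -> p != q ->
  p.-Sylow(G) P -> q.-Sylow(G) Q -> ~~ (P <| G) -> ~~ (Q <| G) ->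
  5 <= delta_cd G.
Proof.
move=> p_pr q_pr neq_pq sylP sylQ nnP nnQ.
have [ltp badp _] := nonnormal_Sylow_card p_pr sylP nnP.
have [ltq badq _] := nonnormal_Sylow_card q_pr sylQ nnQ.
have disj : [disjoint 'Syl_p(G) & 'Syl_q(G)].
  rewrite disjoint_subset; apply/subsetP => R; rewrite !inE => sylR.
  apply: contra nnP => sylR'; have [x Gx ->] := Sylow_trans sylR sylP.
  have -> : R :=: 1.
    apply: card1_trivg; apply: pnat_1 (pHall_pgroup sylR) _.
    apply: pi_pnat (pHall_pgroup sylR') _; rewrite !inE.
    by rewrite eq_sym.
  by rewrite conjs1g normal1.
have := card_le_delta_cd (S := 'Syl_p(G) :|: 'Syl_q(G)).
rewrite cardsU disjoint_setI0 // cards0 subn0 => le.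
have {}le : #|'Syl_p(G)| + #|'Syl_q(G)| <= delta_cd G.
  by apply: le => H /setUP[/badp | /badq].
apply: leq_trans le; apply: leq_trans (leq_add ltp ltq).
have := prime_gt1 p_pr; have := prime_gt1 q_pr; move: neq_pq; clear; lia.
Qed.

(* Here the product of Z(G) and the normal subgroup Q of order 3 has larger
   measure than both 1 and G. *)
Lemma delta_nonnormal_Sylow2 P : 2.-Sylow(G) P -> ~~ (P <| G) ->
  #|'Syl_2(G)| = 3 -> 5 <= delta_cd G.
Proof.
move=> sylP nnP oS; have [_ badS []//] := nonnormal_Sylow_card (isT : prime 2) sylP nnP.
move=> [nP oSP]; have [sPG pP _] := and3P sylP.
have oG : #|G| = (#|P| * 3)%N by rewrite -oS oSP Lagrange.
have [Q sylQ] := Sylow_exists 3 G; have [sQG pQ _] := and3P sylQ.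
have oQ : #|Q| = 3.
  rewrite (card_Hall sylQ) oG partnM // part_p'nat; last first.
    by apply: sub_in_pnat pP => q _ /eqnP->.
  by rewrite mul1n part_pnat_id.
have [nQ | nnQ] := boolP (Q <| G); last first.
  by apply: delta_Sylow_pair sylP sylQ nnP nnQ.
(* A generator of the normal subgroup [Q] has its conjugates among the two nontrivial elements of
   [Q], so its centraliser has index at most 2. *)
have leC : (#|G| <= 2 * #|'C_G(Q)|)%N.
  have : cyclic Q by apply: prime_cyclic; rewrite oQ.
  case/cyclicP=> q defQ; have Qq : q \in Q by rewrite defQ cycle_id.
  rewrite defQ cent_cycle -(Lagrange (subsetIl G 'C[q])) mulnC leq_mul2r.
  rewrite index_cent1; apply/orP; right.
  have -> : 2 = #|Q^#|.
    by move: oQ; rewrite (cardsD1 1) group1 => -[].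
  apply: subset_leq_card; rewrite class_sub_norm ?normD1 ?normal_norm //.
  rewrite !inE Qq andbT; apply/eqP => q1.
  by move: oQ; rewrite defQ q1 cycle1 cards1.
have tiQZ : Q :&: 'Z(G) = 1.
  apply: prime_TIg; first by rewrite oQ.
  apply: contra nnP => sQZ; rewrite /normal sPG.
  have sQN : Q \subset 'N_G(P).
    rewrite subsetI sQG cents_norm // centsC.
    by rewrite (subset_trans sPG) // centsC (subset_trans sQZ) ?subsetIr.
  move: sQN; rewrite nP => /cardSg; rewrite oQ => d3.
  by have := pnat_dvd d3 pP.
have sJG : Q <*> 'Z(G) \subset G by rewrite join_subG sQG center_sub.
have oJ : #|Q <*> 'Z(G)| = (3 * #|'Z(G)|)%N.
  rewrite norm_joinEl ?TI_cardMg ?oQ //.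
  by rewrite (subset_trans sQG) // normal_norm ?center_normal.
have Z0 := cardG_gt0 'Z(G); have G0 := cardG_gt0 G.
(* The measure of the join is at least 3/2 times |Z(G)| |G|, to be compared with |Z(G)| |G| for [G]
   and |G| for 1. Doubling avoids the fraction. *)
have mJ : (2 * cd_measure G (Q <*> 'Z(G))%G >= 3 * #|'Z(G)| * #|G|)%N.
  rewrite /cd_measure /= cent_joing_center oJ mulnCA leq_mul2l.
  by rewrite leC orbT.
have nG : G \notin CD.
  apply: notin_cd_lattice sJG _; rewrite -(ltn_pmul2l (isT : 0 < 2)).
  apply: leq_trans mJ; rewrite /cd_measure -/('Z(G)).
  rewrite (mulnC #|G|) mulnA ltn_mul2r G0 ltn_mul2r Z0; exact: isT.
have n1 : 1%G \notin CD.
  apply: notin_cd_lattice sJG _; rewrite -(ltn_pmul2l (isT : 0 < 2)).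
  apply: leq_trans mJ; rewrite /cd_measure /= cards1 mul1n cent1T setIT.
  rewrite ltn_mul2r G0 /=; apply: (leq_pmulr 3 Z0).
have ntP : P :!=: 1 by apply: contraNneq nnP => ->; apply: normal1.
pose S := G |: (1%G |: 'Syl_2(G)).
have oS5 : #|S| = 5.
  have nG2 : ~~ 2.-group G.
    apply: contra nnP => pG; suffices -> : P :=: G by apply: normal_refl.
    by apply/esym; apply: (sub_pHall sylP).
  rewrite !cardsU1 oS !inE.
  have /negPf-> : ~~ 2.-Sylow(G) G by apply: contra nG2 => /pHall_pgroup.
  have /negPf-> : ~~ 2.-Sylow(G) 1%G.
    apply: contra ntP => /card_Hall /=; rewrite -(card_Hall sylP) cards1 => oP.
    by apply/eqP; apply: card1_trivg.
  have /negPf-> // : G != 1%G.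
  by apply: contraNneq nG2 => ->; apply: pgroup1.
rewrite -oS5; apply: card_le_delta_cd => H.
by rewrite !in_setU1 => /or3P[/eqP->|/eqP->|/badS]; rewrite ?sub1G ?subxx.
Qed.

(* A Sylow 2-subgroup V is normal of order 4 and abelian: if both 1 and V were
   in the lattice, then 4 |C(V)| = |G| = 4 |P| although |C(V)| is even. *)
Lemma delta_nonnormal_Sylow3 P : 3.-Sylow(G) P -> ~~ (P <| G) ->
  #|'Syl_3(G)| = 4 -> 5 <= delta_cd G.
Proof.
move=> sylP nnP oS; have [_ badS []//] := nonnormal_Sylow_card (isT : prime 3) sylP nnP.
move=> [nP oSP]; have [sPG pP _] := and3P sylP.
have oG : #|G| = (#|P| * 4)%N by rewrite -oS oSP Lagrange.
have [V sylV] := Sylow_exists 2 G; have [sVG pV _] := and3P sylV.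
have oV : #|V| = 4.
  rewrite (card_Hall sylV) oG partnM // part_p'nat; last first.
    by apply: sub_in_pnat pP => q _ /eqnP->.
  by rewrite mul1n part_pnat_id.
have [nV | nnV] := boolP (V <| G); last first.
  by apply: delta_Sylow_pair sylP sylV nnP nnV.
have bad (R : {group gT}) : R \subset G -> R \notin CD -> R \notin 'Syl_3(G) -> 5 <= delta_cd G.
  move=> sRG nR sylR; have <- : #|R |: 'Syl_3(G)| = 5 by rewrite cardsU1 sylR oS.
  by apply: card_le_delta_cd => H /setU1P[-> | /badS].
have [cd1 | n1] := boolP (1%G \in CD); last first.
  apply: bad n1 _; rewrite ?sub1G // inE; apply: contra nnP => /card_Hall/= o1.
  suffices -> : P :=: 1 by apply: normal1.
  by apply: card1_trivg; rewrite (card_Hall sylP) -o1 cards1.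
have [cdV | nV'] := boolP (V \in CD); last first.
  apply: bad nV' _; rewrite ?inE //; apply/negP => /pHall_pgroup.
  by rewrite /pgroup oV.
have := cd_lattice_measure cdV; rewrite -(cd_lattice_measure cd1).
rewrite /cd_measure /= cards1 mul1n cent1T setIT oV oG mulnC => /eqP.
rewrite eqn_pmul2r // => /eqP oC.
have cV : V \subset 'C_G(V).
  by rewrite subsetI sVG; apply: (p2group_abelian pV); rewrite oV.
have := cardSg cV; rewrite oC oV => d4.
by have := pnat_dvd d4 pP.
Qed.

Lemma delta_nonnilpotent : ~~ nilpotent G -> 5 <= delta_cd G.
Proof.
move=> nnG; have [p [P [p_pr sylP nnP]]] :
    exists p, exists P, [/\ prime p, p.-Sylow(G) P & ~~ (P <| G)].
  have [/existsP[P /andP[/SylowP[p p_pr sylP] nnP]] | ] :=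
    boolP [exists P : {group gT}, Sylow G P && ~~ (P <| G)]; first by exists p, P.
  rewrite negb_exists => /forallP nS; case/negP: nnG.
  apply: nilpotent_Sylow_normal => p P p_pr sylP.
  have := nS P; rewrite negb_and negbK; case/orP => // /SylowP[].
  by exists p.
have [ltp badS _] := nonnormal_Sylow_card p_pr sylP nnP.
rewrite leqNgt; apply/negP => lt5.
have le4 : #|'Syl_p(G)| <= 4.
  by rewrite -ltnS; apply: leq_ltn_trans lt5; apply: card_le_delta_cd.
have := card_Syl_mod G p_pr.
have p_gt1 := prime_gt1 p_pr; have := leq_trans ltp le4.
(* The number of Sylow p-subgroups is above p, at most 4 and 1 modulo p: it is 3 for p = 2 and 4 for
   p = 3. *)
move=> ltp4; have [p2 | p3] : p = 2 \/ p = 3.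
    by move: p_gt1 ltp4; clear; lia.
  rewrite {}p2 in sylP ltp le4 *.
  move=> o1; have o3 : #|'Syl_2(G)| = 3 by move: ltp le4 o1; clear; lia.
  by have := delta_nonnormal_Sylow2 sylP nnP o3; rewrite leqNgt lt5.
rewrite {}p3 in sylP ltp le4 * => _.
have o4 : #|'Syl_3(G)| = 4 by move: ltp le4; clear; lia.
by have := delta_nonnormal_Sylow3 sylP nnP o4; rewrite leqNgt lt5.
Qed.
End NonNilpotent.

(** * Abelian groups *)

Lemma size_divisors_ppow p k : prime p -> size (divisors (p ^ k)) = k.+1.
Proof.
move=> p_pr; have p_gt1 := prime_gt1 p_pr.
rewrite -[RHS](size_iota 0) -[RHS](size_map (expn p)); apply/perm_size/uniq_perm.
- exact: divisors_uniq.
- rewrite map_inj_uniq ?iota_uniq //; exact: expnI.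
move=> d; rewrite -dvdn_divisors ?expn_gt0 ?prime_gt0 //.
apply/(dvdn_pfactor _ _ p_pr)/mapP => [[i le ->] | [i]].
  by exists i; rewrite // mem_iota.
by rewrite mem_iota => lt ->; exists i.
Qed.

Lemma size_divisors_mul_primes p q : prime p -> prime q -> p != q ->
  size (divisors (p * q)) = 4.
Proof.
move=> p_pr q_pr neq_pq.
have [p_gt1 q_gt1] := (prime_gt1 p_pr, prime_gt1 q_pr).
rewrite -[4]/(size [:: 1; p; q; p * q])%N; apply/perm_size/uniq_perm.
- exact: divisors_uniq.
- rewrite /= !inE; move: neq_pq; nia.
move=> d; rewrite -dvdn_divisors ?muln_gt0 ?prime_gt0 //.
apply/idP/idP => [dpq | ]; last first.
  by rewrite !inE => /or4P[]/eqP->;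
     rewrite ?dvd1n ?dvdnn ?(dvdn_mulr _ (dvdnn p)) ?(dvdn_mull _ (dvdnn q)).
have dprime r e : prime r -> e %| r -> (e == 1%N) || (e == r).
  by move=> /primeP[_ /(_ e)].
rewrite !inE; have [/dvdnP[e def_d] | ndp] := boolP (p %| d).
  move: dpq; rewrite def_d mulnC dvdn_pmul2l ?prime_gt0 // => /(dprime _ _ q_pr).
  by case/orP=> /eqP->; rewrite ?muln1 eqxx !orbT.
move: dpq; rewrite Gauss_dvdr 1?coprime_sym ?prime_coprime // => /(dprime _ _ q_pr).
by case/orP=> /eqP->; rewrite eqxx ?orbT.
Qed.

(** Besides 1, p, q, pq and pqd there is the divisor qd, which is new unless d = p; in that case p *
    p takes its place. *)
Lemma size_divisors_gt5 p q d : prime p -> prime q -> p != q -> 1 < d ->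
  5 < size (divisors (p * q * d)).
Proof.
move=> p_pr q_pr neq_pq d_gt1.
have [p_gt1 q_gt1] := (prime_gt1 p_pr, prime_gt1 q_pr).
have n_gt0 : 0 < (p * q * d)%N by rewrite !muln_gt0; lia.
have six s : uniq s -> all (fun e => e %| p * q * d)%N s ->
    size s <= size (divisors (p * q * d)).
  move=> us /allP s_n; apply: uniq_leq_size => // e /s_n.
  by rewrite dvdn_divisors.
have qp : p != (q * d)%N.
  apply: contraNneq neq_pq => /esym def_p.
  by rewrite eq_sym -dvdn_prime2 // -def_p dvdn_mulr.
have [dp | ndp] := eqVneq d p.
  apply: (six [:: 1; p; q; p * q; p * p; p * q * p]%N).
    have qpp : q != (p * p)%N.
      apply: contraNneq neq_pq => def_q.
      by rewrite -dvdn_prime2 // def_q dvdn_mulr.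
    rewrite /= !inE !negb_or !andbT; move: neq_pq qpp; clear -p_gt1 q_gt1.
    by move=> *; repeat (apply/andP; split); nia.
  rewrite dp /= dvd1n dvdnn !andbT /=; apply/and4P; split; apply/dvdnP;
    [exists (q * p)%N | exists (p * p)%N | exists p | exists q]; lia.
apply: (six [:: 1; p; q; p * q; q * d; p * q * d]%N).
  rewrite /= !inE !negb_or !andbT; move: neq_pq qp ndp; clear -p_gt1 q_gt1 d_gt1.
  by move=> *; repeat (apply/andP; split); nia.
rewrite /= dvd1n dvdnn !andbT /=; apply/and4P; split; apply/dvdnP;
  [exists (q * d)%N | exists (p * d)%N | exists d | exists p]; lia.
Qed.

(** A power [p ^ k] has k + 1 divisors. Otherwise two distinct primes p and q divide n, and n = pq,
    since a further factor would give six divisors. *)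
Lemma few_divisors n : 0 < n -> size (divisors n) <= 5 ->
  [\/ size (divisors n) <= 3,
      size (divisors n) = 4 /\
        ((exists p q : nat, [/\ prime p, prime q & n = p * q]%N) \/
         (exists2 p : nat, prime p & n = p ^ 3)%N)
    | size (divisors n) = 5 /\ exists2 p : nat, prime p & n = (p ^ 4)%N].
Proof.
move=> n_gt0 le5; have [n1 | n_gt1] := leqP n 1.
  by constructor 1; have -> : n = 1%N by move: n_gt0 n1; clear; lia.
have p_pr := pdiv_prime n_gt1; set p := pdiv n in p_pr.
have [pn | npn] := boolP (p.-nat n).
  have [k def_n] := p_natP pn; move: le5; rewrite def_n size_divisors_ppow //.
  case: k def_n => [|[|[|[|[|k]]]]] def_n // _; [constructor 1 | constructor 1
    | constructor 1 | constructor 2 | constructor 3] => //.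
    by split=> //; right; exists p.
  by split=> //; exists p.
have [q q_pr qn] : exists2 q, prime q & (q %| n) && (q != p).
  move: npn; rewrite /pnat n_gt0 /= => /allPn[q].
  by rewrite mem_primes => /and3P[q_pr _ qn]; exists q; rewrite ?qn.
have [qn' neq] := andP qn; rewrite eq_sym in neq.
have /dvdnP[d def_n] : p * q %| n.
  rewrite Gauss_dvd ?pdiv_dvd //.
  by rewrite prime_coprime // dvdn_prime2.
have [d1 | d_gt1] := leqP d 1; last first.
  have := size_divisors_gt5 p_pr q_pr neq d_gt1.
  by rewrite mulnC -def_n ltnNge le5.
have def_n' : n = (p * q)%N.
  by rewrite def_n; case: d d1 def_n n_gt1 => [|[|d]] //; rewrite ?mul1n // => _ ->.
constructor 2; rewrite def_n' size_divisors_mul_primes //.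
by split=> //; left; exists p, q.
Qed.

Section Abelian.

Variables (gT : finGroupType) (G : {group gT}).

(** All centralisers are [G], so the measure of [H] is |H| |G| and only [G] itself attains the
    maximum. *)
Lemma delta_abelian : abelian G -> delta_cd G = #|subgroups G|.-1.
Proof.
move=> cGG; rewrite /delta_cd.
suffices -> : cd_lattice G = [set G] by rewrite [in RHS](cardsD1 G) [G \in _]inE subxx.
apply/setP => H; rewrite in_set1 cd_latticeE.
have [sHG /= | nHG] := boolP (H \subset G); last first.
  by apply/esym/negP => /eqP eHG; rewrite eHG subxx in nHG.
have mE (K : {group gT}) : K \subset G -> cd_measure G K = (#|K| * #|G|)%N.
  move=> sKG; rewrite /cd_measure (setIidPl _) // centsC.
  exact: subset_trans sKG cGG.
have -> : max_cd_measure G = (#|G| * #|G|)%N.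
  apply/eqP; rewrite eqn_leq -{2}mE // cd_measure_le_max // andbT.
  apply/bigmax_leqP => K; rewrite inE => sKG.
  by rewrite mE // leq_mul2r subset_leq_card ?orbT.
rewrite mE // eqn_pmul2r //; apply/eqP/eqP => [oH | -> //].
by apply/group_inj/eqP; rewrite eqEcard sHG oH leqnn.
Qed.

Lemma card_subgroups_cyclic : cyclic G -> #|subgroups G| = size (divisors #|G|).
Proof.
move=> cycG; rewrite cardE -(size_map (fun H : {group gT} => #|H|)).
apply/perm_size/uniq_perm; last 1 first.
- move=> d; rewrite -dvdn_divisors //; apply/mapP/idP => [[H] | dG].
    by rewrite mem_enum inE => /cardSg dH ->.
  have [x defG] := cyclicP cycG.
  exists <[x ^+ (#[x] %/ d)]>%G.
    by rewrite mem_enum inE defG cycleX.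
  rewrite defG -orderE in dG *.
  by rewrite /= -orderE orderXdiv ?divnA ?dvdn_div // mulKn ?order_gt0.
- rewrite map_inj_in_uniq ?enum_uniq // => H K.
  rewrite !mem_enum !inE => sHG sKG /eqP oHK.
  by apply/group_inj/eqP; rewrite (eq_subG_cyclic cycG).
exact: divisors_uniq.
Qed.

(** Rank at least 2 gives an elementary abelian [E] of order p^2, which has p + 3 subgroups. As [G]
    has at most five subgroups, p = 2 and [G] cannot be larger than [E]. *)
Lemma delta_abelian_noncyclic : abelian G -> ~~ cyclic G -> delta_cd G < 5 ->
  delta_cd G = 4 /\ G \isog [set: ('Z_2 * 'Z_2)%type].
Proof.
move=> cGG ncG; rewrite abelian_rank1_cyclic // -ltnNge in ncG.
have /rank_geP[E] := ncG.
case/nElemP => p Ep2E; have [sEG abE oE] := pnElemP Ep2E.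
have p_pr := pnElem_prime Ep2E.
have p_gt1 := prime_gt1 p_pr.
have oE2 := card_pnElem Ep2E.
pose S := 1%G |: 'E_p^1(E).
have oS : #|S| = p.+2.
  rewrite cardsU1 (card_p1Elem_p2Elem Ep2E).
  suffices /negPf-> : 1%G \notin 'E_p^1(E) by [].
  by apply/negP => /card_p1Elem; rewrite cards1 => p1; rewrite -p1 in p_gt1.
rewrite delta_abelian // => lt5.
have sS H : H \in S -> H \subset E /\ H != E.
  case/setU1P=> [-> | EH].
    split; first exact: sub1G.
    apply: contraTneq p_gt1 => E1; rewrite -E1 cards1 in oE2.
    by case: p oE2 {p_pr S oS abE oE Ep2E} => [|[|?]].
  split; first by have [] := pnElemP EH.
  apply: contraTneq p_gt1 => EE; have := card_p1Elem EH; rewrite EE oE2.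
  by rewrite -leqNgt; clear; case: p => [|[|p]] //; nia.
have lE : #|E |: S| = p.+3.
  rewrite cardsU1 oS; suffices /negPf-> : E \notin S by [].
  by apply/negP => /sS[_]; rewrite eqxx.
have sES : E |: S \subset subgroups G.
  apply/subsetP => H /setU1P[-> | /sS[sHE _]]; rewrite inE //.
  exact: subset_trans sEG.
have eGE : G = E.
  apply/eqP; apply: contraLR lt5 => neGE; rewrite -leqNgt.
  have : #|G |: (E |: S)| <= #|subgroups G|.
    by apply/subset_leq_card; rewrite subUset sES sub1set inE subxx.
  rewrite cardsU1 lE; have -> : G \notin E |: S.
    apply/negP; rewrite in_setU1 (negPf neGE) /= => /sS[sGE _].
    by case/eqP: neGE; apply/group_inj/eqP; rewrite eqEsubset sGE.
  move: p_gt1; clear; lia.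
have := subset_leq_card sES; rewrite lE => le.
have p2 : p = 2 by move: le lt5 p_gt1; clear; lia.
split; first by move: le lt5; rewrite p2; clear; lia.
rewrite p2 -eGE in abE oE2; rewrite (isog_abelem_card _ abE) oE2.
rewrite cardsT card_prod card_ord eqxx andbT abelemE //; apply/andP; split.
  by apply/centsP => -[a b] _ [c d] _; congr (_, _); apply: Zp_mulgC.
apply/exponentP => -[a b] _; congr (_, _); apply: val_inj.
  by case: a => [[|[|]]].
by case: b => [[|[|]]].
Qed.

End Abelian.

(** * Nonabelian p-groups *)

Section PGroups.

Variables (gT : finGroupType).
Implicit Types (x y z : gT) (p : nat) (G H K E : {group gT}).

Lemma expg_index_normal G H x : H <| G -> x \in G -> x ^+ #|G : H| \in H.
Proof.
move=> nHG Gx; have Nx := subsetP (normal_norm nHG) x Gx.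
apply: coset_idr; first exact: groupX.
by rewrite morphX // -card_quotient ?normal_norm // expg_cardG ?mem_quotient.
Qed.

Lemma cd_measure_center G : cd_measure G 'Z(G)%G = cd_measure G G.
Proof.
rewrite /cd_measure mulnC; congr (_ * _)%N.
by rewrite (setIidPl _) // centsC subsetIr.
Qed.

Lemma generators_p2Elem p G z a : prime p -> z \in 'Z(G) -> #[z] = p ->
    a \in G -> #[a] = p -> a \notin <[z]> ->
  (<[z]> <*> <[a]>)%G \in 'E_p^2(G).
Proof.
move=> p_pr Zz oz Ga oa nza; have /centerP[Gz cGz] := Zz.
have sEG : <[z]> <*> <[a]> \subset G by rewrite join_subG !cycle_subG Gz.
have ti : <[z]> :&: <[a]> = 1.
  rewrite setIC prime_TIg -?orderE ?oa // cycle_subG //.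
have caz : <[a]> \subset 'C(<[z]>).
  by rewrite cent_cycle cycle_subG; apply/cent1P; rewrite /commute cGz.
have defE := cprodEY caz.
apply/pnElemP; split=> //.
  rewrite (cprod_abelem p defE) !(prime_abelem p_pr) //; exact/esym.
rewrite /= cent_joinEr // TI_cardMg // -!orderE oz oa.
exact: (pfactorK 2 p_pr).
Qed.

Lemma p2Elem_exists p G z : p.-group G -> z \in 'Z(G) -> #[z] = p ->
    #|'Ohm_1(G)| != p ->
  exists a, [/\ a \in G, #[a] = p & a \notin <[z]>].
Proof.
move=> pG Zz oz nO; have Gz := subsetP (center_sub G) z Zz.
have ntG : G :!=: 1.
  apply: contraNneq nO => G1; have /eqP := G1; rewrite -Ohm1_eq1 => /eqP->.
  by move: Gz; rewrite G1 => /set1P z1; rewrite -oz z1 cards1 order1.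
have [p_pr _ _] := pgroup_pdiv pG ntG.
have defO := OhmE 1 pG; rewrite expn1 in defO.
have [sO | /subsetPn[a /LdivP[Ga ap] nza]] := boolP ('Ldiv_p(G) \subset <[z]>).
  case/eqP: nO; rewrite -oz; apply: eq_card; apply/setP/eqP.
  rewrite eqEsubset defO gen_subG sO cycle_subG mem_gen //.
  by apply/LdivP; rewrite Gz -oz expg_order.
exists a; split=> //; apply/prime_nt_dvdP => //.
  by rewrite order_eq1; apply: contraNneq nza => ->; apply: group1.
by rewrite order_dvdn ap.
Qed.

(** If [E] does not contain the center, none of its subgroups is in the lattice. Otherwise [E] is
    the center, and the exceptions are 1, the p + 1 subgroups of order p, and [<[x]>] for some [x]
    outside [E], since a cyclic group cannot contain [E]. *)
Lemma delta_center_not_prime p G E : p.-group G -> ~~ abelian G ->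
  #|'Z(G)| != p -> E \in 'E_p^2(G) -> 5 <= delta_cd G.
Proof.
move=> pG nabG oZ Ep2E; have [sEG abE _] := pnElemP Ep2E.
have p_pr := pnElem_prime Ep2E; have p_gt1 := prime_gt1 p_pr.
have oE := card_pnElem Ep2E.
have [sZE | nsZE] := boolP ('Z(G) \subset E); last first.
  have ncE : ~~ cyclic E by rewrite (abelem_cyclic abE) oE pfactorK.
  apply: leq_trans (five_le_subgroups ncE) _.
  apply: card_le_delta_cd => H; rewrite inE => sHE.
  split; first exact: subset_trans sHE sEG.
  by apply: contra nsZE => /cd_lattice_center sZH; apply: subset_trans sHE.
have ntG : G :!=: 1 by apply: contraNneq nabG => ->; apply: abelian1.
have oZ2 : #|'Z(G)| = (p ^ 2)%N.
  have := cardSg sZE; rewrite oE => /(dvdn_pfactor _ _ p_pr)[i le oi].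
  move: oZ; rewrite oi; case: i le oi => [|[|[|]]] // _; last by rewrite expn1 eqxx.
  rewrite expn0 => o1; have := trivg_center_pgroup pG (card1_trivg o1).
  by move/eqP; rewrite (negPf ntG).
have defZ : 'Z(G) = E by apply/eqP; rewrite eqEcard sZE oE oZ2 leqnn.
have [x Gx nEx] : exists2 x, x \in G & x \notin E.
  apply/subsetPn; rewrite -defZ; apply: contra nabG => sGZ.
  by apply: subset_trans sGZ (subsetIr _ _).
pose S := <[x]>%G |: (1%G |: 'E_p^1(E)).
have oS : #|S| = p.+3.
  rewrite !cardsU1 (card_p1Elem_p2Elem Ep2E) in_setU1.
  have /negPf-> : <[x]>%G != 1%G.
    apply: contraNneq nEx => /(congr1 val)/= /eqP; rewrite cycle_eq1 => /eqP->.
    exact: group1.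
  have /negPf-> : <[x]>%G \notin 'E_p^1(E).
    by apply: contra nEx => /pnElemP[]; rewrite cycle_subG.
  suffices /negPf-> : 1%G \notin 'E_p^1(E) by [].
  by apply/negP => /card_p1Elem; rewrite cards1 => p1; rewrite -p1 in p_gt1.
suffices: #|S| <= delta_cd G by rewrite oS; apply: leq_trans; rewrite !ltnS.
apply: card_le_delta_cd => H; rewrite !in_setU1.
have nZ (K : {group gT}) : #|K| < p ^ 2 -> K \notin cd_lattice G.
  move=> lt; apply: contraL lt => /cd_lattice_center/subset_leq_card.
  by rewrite oZ2 -leqNgt.
case/or3P=> [/eqP-> | /eqP-> | EH].
- rewrite cycle_subG; split=> //; apply/negP => /cd_lattice_center sZx.
  have := cyclicS sZx (cycle_cyclic x).
  by rewrite /= defZ (abelem_cyclic abE) oE pfactorK.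
- by rewrite sub1G nZ ?cards1 // (ltn_exp2l 0 2 p_gt1).
have [sHE _ _] := pnElemP EH; rewrite (subset_trans sHE sEG) nZ //.
by rewrite (card_p1Elem EH) -{1}(expn1 p) ltn_exp2l.
Qed.

(** All elements outside the maximal cyclic subgroup [<[x]>] have order 4, and an element [t] of
    [<[x]>] is the quotient of the two outside elements [t * y] and [y]. *)
Lemma quaternion_order4_gen G H : extremal_class G = Quaternion -> H \subset G ->
  (forall t, t \in G -> #[t] = 4 -> t \in H) -> H :=: G.
Proof.
move=> /quaternion_classP[n n_gt2 isoG] sHG oH.
have [[x y] gen _] := generators_quaternion n_gt2 isoG.
have [_ Gx _ /setDP[Gy nXy]] := gen.
have [[_ o4 _] _ _ _ _] := quaternion_structure n_gt2 gen isoG.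
apply/eqP; rewrite eqEsubset sHG; apply/subsetP => t Gt.
have out u : u \in G -> u \notin <[x]> -> u \in H.
  by move=> Gu nXu; apply: oH => //; apply: o4; apply/setDP.
have [Xt | nXt] := boolP (t \in <[x]>); last exact: out.
rewrite -(groupMr t (out _ Gy nXy)); apply: out; first exact: groupM.
by rewrite groupMl.
Qed.

(** If the center is in the lattice, the maximum is 2 |G|, and comparison with the abelian subgroup
    [<[x]>] forces order 8, where only 1 is an exception. If not, the maximum exceeds 2 |G|, and 1,
    the center, [G], [<[y]>] and [<[x * y]>] are exceptions. *)
Lemma delta_quaternion G : 2.-group G -> extremal_class G = Quaternion ->
  delta_cd G < 3 \/ 5 <= delta_cd G.
Proof.
move=> pG /quaternion_classP[n n_gt2 isoG].
have [[x y] gen _] := generators_quaternion n_gt2 isoG.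
have [oG Gx ox /setDP[Gy nXy]] := gen.
have [[_ o4 _] _ [defZ oZ inv_uniq _ _] _ _] := quaternion_structure n_gt2 gen isoG.
have sXG : <[x]> \subset G by rewrite cycle_subG.
have oGX : #|G| = (2 * #[x])%N by rewrite oG ox -expnS prednK // ltnW // ltnW.
have ox4 : 4 <= #[x] by rewrite ox -[4]/(2 ^ 2)%N leq_exp2l // -ltnS prednK // ltnW // ltnW.
have mZ : cd_measure G 'Z(G)%G = (2 * #|G|)%N.
  by rewrite cd_measure_center /cd_measure -/('Z(G)) oZ mulnC.
have sZH H : H \subset G -> H :!=: 1 -> 'Z(G) \subset H.
  move=> sHG ntH; have [_ d2 _] := pgroup_pdiv (pgroupS sHG pG) ntH.
  have [//|u Hu ou] := Cauchy _ d2.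
  by rewrite defZ -(inv_uniq u) ?cycle_subG // (subsetP sHG).
have [cdZ | ncdZ] := boolP ('Z(G)%G \in cd_lattice G).
  left; have mstar := cd_lattice_measure cdZ; rewrite mZ in mstar.
  have mX : #[x] * #[x] <= 2 * #|G|.
    rewrite mstar; apply: leq_trans (cd_measure_le_max sXG).
    rewrite /cd_measure leq_mul2l; apply/orP; right; apply: subset_leq_card.
    by rewrite subsetI sXG; apply: cycle_abelian.
  have oG8 : #|G| = 8.
    by rewrite oGX in mX *; move: mX ox4; clear; nia.
  suffices: delta_cd G <= #|[set 1%G : {group gT}]| by rewrite cards1; case: delta_cd => [|[]].
  apply/subset_leq_card/subsetP => H; rewrite in_setD in_set1 [H \in subgroups G]inE.
  case/andP=> ncdH sHG; apply: contraR ncdH => ntH.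
  rewrite cd_latticeE sHG eqn_leq cd_measure_le_max //= -mstar oG8.
  have d2 := cardSg (sZH H sHG ntH); have := cardSg sHG; rewrite oZ oG8 in d2 *.
  have [k oH] := p_natP (pgroupS sHG pG); rewrite oH -[8]/(2 ^ 3)%N dvdn_Pexp2l // in d2 *.
  case: k oH d2 => [|[|[|[|k]]]] // oH _ _.
  - have -> : H = 'Z(G)%G.
      by apply/group_inj/esym/eqP; rewrite eqEcard sZH // oH oZ.
    by rewrite mZ oG8.
  - rewrite /cd_measure oH; apply: (@leq_mul 4 4 4) => //.
    have {1}<- : #|H| = 4 := oH; apply: subset_leq_card; rewrite subsetI sHG.
    by apply: (p2group_abelian (pgroupS sHG pG)); rewrite oH.
  have -> : H = G by apply/group_inj/eqP; rewrite eqEcard sHG oH oG8.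
  by rewrite -cd_measure_center mZ oG8.
right.
have mstar : 2 * #|G| < max_cd_measure G.
  rewrite -mZ ltn_neqAle cd_measure_le_max ?center_sub // andbT.
  by apply: contra ncdZ => e; rewrite cd_latticeE center_sub.
have bad H : H \subset G -> cd_measure G H <= 2 * #|G| -> H \subset G /\ H \notin cd_lattice G.
  move=> sHG le; split=> //; rewrite cd_latticeE negb_and; apply/orP; right.
  by rewrite neq_ltn (leq_ltn_trans le mstar).
have badc t : t \in G -> t \notin <[x]> -> <[t]> \subset G /\ <[t]>%G \notin cd_lattice G.
  move=> Gt nXt; have ot : #[t] = 4 by apply: o4; apply/setDP.
  apply: (bad <[t]>%G); first by rewrite cycle_subG.
  have sCG : 'C_G[t] \subset G := subsetIl _ _.
  (* An element of order 4 is not central, so the measure of [<[t]>] is at most 4 |G| / 2. *)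
  have : 1 < #|G : 'C_G[t]|.
    rewrite indexg_gt1; apply/negP => sGC.
    suffices : #[t] <= #|'Z(G)| by rewrite ot oZ.
    apply: subset_leq_card; rewrite cycle_subG.
    by apply/centerP; split=> // u /(subsetP sGC)/setIP[_ /cent1P].
  rewrite /cd_measure /= -orderE ot cent_cycle -(Lagrange sCG).
  move: #|'C_G[t]| #|G : _| => c i; clear; nia.
have Gxy : x * y \in G by apply: groupM.
have nXxy : x * y \notin <[x]> by rewrite groupMl ?cycle_id.
pose s : seq {group gT} := [:: 1%G; 'Z(G)%G; G; <[y]>%G; <[x * y]>%G].
have os : #|[set H in s]| = 5.
  rewrite cardsE; apply/card_uniqP.
  have neq H K : #|H| != #|K| -> H != K by apply: contraNneq => ->.
  have oy : #[y] = 4 by apply: o4; apply/setDP.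
  have neq_cyc : <[y]>%G != <[x * y]>%G.
    apply: contraNneq nXy => /(congr1 val)/= eq_yxy.
    have xy : x \in <[y]>.
      have : x * y \in <[y]> by rewrite eq_yxy cycle_id.
      by rewrite groupMr ?cycle_id.
    suffices -> : <[x]> = <[y]> by apply: cycle_id.
    by apply/eqP; rewrite eqEcard cycle_subG xy -!orderE oy.
  have oyc t : t \in G -> t \notin <[x]> -> #|<[t]>%G| = 4.
    by move=> Gt nXt; apply: o4; apply/setDP.
  have oG8 : 8 <= #|G| by rewrite oGX (@leq_mul 2 4).
  have nG H : #|H| < 8 -> H != G.
    by move=> lt; apply: neq; rewrite neq_ltn (leq_trans lt oG8).
  have o1 : #|(1%G : {group gT})| = 1%N := cards1 _.
  rewrite /= !inE !negb_or neq_cyc !andbT !(eq_sym G); apply/and4P; split.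
  - apply/and4P; split; first by apply: neq; rewrite o1 oZ.
    + by apply: nG; rewrite o1.
    + by apply: neq; rewrite o1 oyc.
    by apply: neq; rewrite o1 oyc.
  - apply/and3P; split; first by apply: nG; rewrite oZ.
      by apply: neq; rewrite oZ oyc.
    by apply: neq; rewrite oZ oyc.
  - by apply: nG; rewrite oyc.
  by apply: nG; rewrite oyc.
rewrite -os; apply: card_le_delta_cd => H.
have -> : (H \in [set K in s]) = (H \in s) by rewrite inE.
rewrite !in_cons in_nil orbF => /or4P[/eqP->|/eqP->|/eqP->|/orP[]/eqP->]; last 2 first.
- exact: badc.
- exact: badc.
- apply: bad; first exact: sub1G.
  by rewrite /cd_measure cards1 mul1n cent1T setIT leq_pmull.
- by apply: bad; rewrite ?center_sub // mZ.
by apply: bad; rewrite // -cd_measure_center mZ.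
Qed.
End PGroups.

(** * Nonabelian p-groups with center of order p and a noncentral subgroup of order p *)

Section PrimeCenter.

Variables (gT : finGroupType) (p : nat) (G : {group gT}) (z a : gT).
Implicit Types (x y t : gT) (B H K : {group gT}).

Hypotheses (pG : p.-group G) (nabG : ~~ abelian G).
Hypotheses (defZ : 'Z(G) = <[z]>) (oz : #[z] = p).
Hypotheses (Ga : a \in G) (oa : #[a] = p) (nza : a \notin <[z]>).
Hypothesis lt5 : delta_cd G < 5.

Local Notation CD := (cd_lattice G).

Let E := (<[z]> <*> <[a]>)%G.
(** Only subgroups of [E] are listed; [order_p_in_E] shows that this misses no noncentral subgroup
    of order p. *)
Let S := 1%G |: ('E_p^1(E) :\ 'Z(G)%G).
Let N := 'C_G[a]%G.

Let ntG : G :!=: 1.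
Proof. by apply: contraNneq nabG => ->; apply: abelian1. Qed.

Let p_pr : prime p.
Proof. by have [] := pgroup_pdiv pG ntG. Qed.

Let p_gt1 := prime_gt1 p_pr.

Let Zz : z \in 'Z(G).
Proof. by rewrite defZ cycle_id. Qed.

Let oZ : #|'Z(G)| = p.
Proof. by rewrite defZ -orderE. Qed.

Let Ep2E : E \in 'E_p^2(G).
Proof. exact: generators_p2Elem. Qed.

Let sEG : E \subset G.
Proof. by have [] := pnElemP Ep2E. Qed.

Let cEE : abelian E.
Proof. by have [_ /abelem_abelian] := pnElemP Ep2E. Qed.

Let oE : #|E| = (p ^ 2)%N.
Proof. exact: card_pnElem Ep2E. Qed.

Let Ea : a \in E.
Proof. by rewrite -cycle_subG joing_subr. Qed.

Let sZE : 'Z(G) \subset E.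
Proof. by rewrite defZ joing_subl. Qed.

Let p1_subG (K : {group gT}) B : B \in 'E_p^1(K) -> B \subset K /\ #|B| = p.
Proof. by move=> KB; rewrite (card_p1Elem KB); have [] := pnElemP KB. Qed.

Let notZ B : B \subset G -> #|B| = p -> B != 'Z(G)%G -> ~~ ('Z(G) \subset B).
Proof.
move=> sBG oB; apply: contra => sZB; apply/eqP/group_inj/esym/eqP.
by rewrite eqEcard sZB oB oZ /=.
Qed.

Let not_cd B : ~~ ('Z(G) \subset B) -> B \notin CD.
Proof. by apply: contra => /cd_lattice_center. Qed.

Let Z_p1 : 'Z(G)%G \in 'E_p^1(E).
Proof. by rewrite p1ElemE // !inE sZE oZ eqxx. Qed.

Let not_cd_S B : B \in S -> B \subset G /\ B \notin CD.
Proof.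
case/setU1P=> [-> | /setD1P[nBZ /p1_subG[sBE oB]]].
  rewrite sub1G not_cd // subG1 trivg_card1 oZ; by case: eqP p_gt1 => // ->.
have sBG := subset_trans sBE sEG.
by split=> //; apply: not_cd; apply: notZ.
Qed.

Let oS : #|S| = p.+1.
Proof.
have := card_p1Elem_p2Elem Ep2E; rewrite (cardsD1 'Z(G)%G) Z_p1 add1n => -[oD].
rewrite cardsU1 oD; case: setD1P => // -[_ /p1_subG[_]].
by rewrite cards1 => p1; move: p_gt1; rewrite -p1.
Qed.

Let le_p3 : p <= 3.
Proof. by move: (card_le_delta_cd not_cd_S) lt5; rewrite oS; clear; lia. Qed.

(** Otherwise [z] and [x] generate another group [F] of order p^2. Its p noncentral subgroups of
    order p are not in [S], because such a subgroup together with the center generates both [E] and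
    [F]. That makes 2p + 1 exceptions. *)
Let order_p_in_E x : x \in G -> x ^+ p = 1 -> x \in E.
Proof.
move=> Gx xp; apply: contraLR lt5 => nEx; rewrite -leqNgt.
have ox : #[x] = p.
  apply/prime_nt_dvdP => //; last by rewrite order_dvdn xp.
  by rewrite order_eq1; apply: contraNneq nEx => ->; apply: group1.
have nzx : x \notin <[z]>.
  by rewrite -defZ; apply: contra nEx => /(subsetP sZE).
have Ep2F := generators_p2Elem p_pr Zz oz Gx ox nzx.
set F := (_ <*> _)%G in Ep2F; have [sFG _ _] := pnElemP Ep2F.
have oF := card_pnElem Ep2F.
have Fx : x \in F by rewrite -cycle_subG joing_subr.
have sZF : 'Z(G) \subset F by rewrite defZ joing_subl.
have Z_p1F : 'Z(G)%G \in 'E_p^1(F) by rewrite p1ElemE // !inE sZF oZ eqxx.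
have disj : [disjoint S & 'E_p^1(F) :\ 'Z(G)%G].
  rewrite disjoint_subset; apply/subsetP => B SB; rewrite inE.
  apply/setD1P => -[nBZ /p1_subG[sBF oB]].
  case/setU1P: SB => [B1 | /setD1P[_ /p1_subG[sBE _]]].
    by move: oB p_gt1; rewrite B1 cards1 => <-.
  have nZB : ~~ (B \subset 'Z(G)).
    apply: contra nBZ => sBZ; apply/eqP/group_inj/eqP.
    by rewrite eqEcard sBZ oB oZ /=.
  have full (K : {group gT}) : #|K| = (p ^ 2)%N -> 'Z(G) \subset K ->
      B \subset K -> 'Z(G) <*> B = K.
    move=> oK sZK sBK; apply/eqP; rewrite eqEcard join_subG sZK sBK oK /=.
    have pJ : p.-group ('Z(G) <*> B).
      by apply: pgroupS pG; rewrite join_subG center_sub (subset_trans sBE).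
    have [k oJ] := p_natP pJ; rewrite oJ leq_exp2l //.
    have : #|'Z(G)| < #|'Z(G) <*> B|.
      apply: proper_card; rewrite properE joing_subl /=.
      by apply: contra nZB; apply: subset_trans; apply: joing_subr.
    by rewrite oJ oZ -{1}(expn1 p) ltn_exp2l.
  by case/negP: nEx; rewrite -(full E oE sZE sBE) (full F oF sZF sBF).
have := card_le_delta_cd (S := S :|: ('E_p^1(F) :\ 'Z(G)%G)).
rewrite cardsU disjoint_setI0 // cards0 subn0 oS.
have := card_p1Elem_p2Elem Ep2F; rewrite (cardsD1 'Z(G)%G) Z_p1F add1n => -[->] le.
have {}le : p.+1 + p <= delta_cd G.
  apply: le => B /setUP[/not_cd_S // | /setD1P[nBZ /p1_subG[sBF oB]]].
  have sBG := subset_trans sBF sFG.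
  by split=> //; apply: not_cd; apply: notZ.
by apply: leq_trans le; move: p_gt1; clear; lia.
Qed.

Let S_J B x : x \in G -> (B :^ x)%G \in S -> B \in S.
Proof.
move=> Gx /setU1P[B1 | /setD1P[nBZ /p1_subG[sBE oB]]]; apply/setU1P.
  left; apply/group_inj; apply: (conjsg_inj (x := x)).
  by rewrite conjs1g; apply: (congr1 val B1).
right; rewrite cardJg in oB.
have sBG : B \subset G.
  by rewrite -(conjSg _ _ x) (conjGid Gx) (subset_trans sBE).
apply/setD1P; split.
  apply: contraNneq nBZ => ->; apply/eqP/group_inj => /=.
  by apply: (normsP (normal_norm (center_normal G))).
rewrite p1ElemE // !inE oB eqxx andbT; apply/subsetP => b Bb.
apply: order_p_in_E; first exact: (subsetP sBG).
by apply/eqP; rewrite -order_dvdn -oB order_dvdG.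
Qed.

(** [S] already supplies p + 1, hence at least three, of the at most four exceptions. *)
Let not_cd_two B K : B \subset G -> K \subset G -> B \notin CD -> K \notin CD ->
  B \notin S -> K \notin S -> B = K.
Proof.
move=> sBG sKG nB nK SB SK; apply/eqP; apply: contraLR lt5 => neBK.
rewrite -leqNgt; have : #|B |: (K |: S)| <= delta_cd G.
  by apply: card_le_delta_cd => H /setU1P[-> | /setU1P[-> | /not_cd_S]].
rewrite cardsU1 (cardsU1 K S) oS SK in_setU1 (negPf SB) (negPf neBK).
by apply: leq_trans; rewrite !ltnS.
Qed.

Let not_cd_normal B : B \subset G -> B \notin CD -> B \notin S -> B <| G.
Proof.
move=> sBG ncB SB; rewrite /normal sBG; apply/subsetP => x Gx; rewrite inE.
have -> : B :^ x = B.
  suffices /esym/(congr1 val) : B = (B :^ x)%G by [].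
  apply: not_cd_two; rewrite ?cd_latticeJ //; first exact: (conj_subG Gx).
  by apply: contra SB; apply: S_J.
exact: subxx.
Qed.

(** A subgroup outside both the lattice and [S] is normal and nontrivial, so it meets the center,
    which has prime order. *)
Let center_sub_notin_S B : B \subset G -> B \notin S -> 'Z(G) \subset B.
Proof.
move=> sBG SB; have [/cd_lattice_center // | ncB] := boolP (B \in CD).
have nB := not_cd_normal sBG ncB SB.
have ntB : B :!=: 1.
  by apply: contraNneq SB => B1; apply/setU1P; left; apply/group_inj.
have := meet_center_nil (pgroup_nil pG) nB ntB.
apply: contraR => nZB; rewrite setIC; apply/eqP/prime_TIg => //.
by rewrite oZ.
Qed.

Let card_notin_S B : #|B| != 1%N -> #|B| != p -> B \notin S.
Proof.
move=> B1 Bp; apply/negP => /setU1P[BB | /setD1P[_ /p1_subG[_ oB]]].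
  by rewrite BB cards1 in B1.
by rewrite oB eqxx in Bp.
Qed.

(** The center and [G] have the same measure; if it were not maximal, they would be two exceptions
    outside [S]. *)
Let center_cd : max_cd_measure G = (p * #|G|)%N.
Proof.
have mZ : cd_measure G 'Z(G)%G = (p * #|G|)%N.
  by rewrite cd_measure_center /cd_measure -/('Z(G)) oZ mulnC.
have [/cd_lattice_measure <- // | ncZ] := boolP ('Z(G)%G \in CD).
have ncG : G \notin CD.
  by apply: contra ncZ; rewrite !cd_latticeE center_sub subxx cd_measure_center.
have SZ : 'Z(G)%G \notin S.
  rewrite !in_setU1 in_setD1 eqxx orbF; apply/negP => /eqP/(congr1 val)/= Z1.
  by move: oZ p_gt1; rewrite Z1 cards1 => <-.
have SG : G \notin S.
  apply: contra nabG => /setU1P[-> | /setD1P[_ /p1_subG[sGE _]]].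
    exact: abelian1.
  exact: abelianS sGE cEE.
have eZG := not_cd_two (center_sub G) (subxx G) ncZ ncG SZ SG.
by case/negP: nabG; rewrite -[X in abelian X](congr1 val eZG) center_abelian.
Qed.

(** A normal subgroup of order p in a p-group is central; this is applied inside the normaliser. *)
Let NE : N = 'N_G(<[a]>) :> {set gT}.
Proof.
apply/eqP; rewrite eqEsubset /= -cent_cycle setIS ?cent_sub //=.
rewrite subsetI subsetIl centsC.
have nA : <[a]> <| 'N_G(<[a]>) by rewrite normal_subnorm cycle_subG.
have pNA : p.-group 'N_G(<[a]>) := pgroupS (subsetIl _ _) pG.
have ntA : <[a]> != 1 by rewrite -cardG_gt1 -orderE oa.
have := meet_center_nil (pgroup_nil pNA) nA ntA.
apply: contraR => nsA; apply/eqP/prime_TIg; first by rewrite -orderE oa.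
by apply: contra nsA => sAZ; apply: subset_trans sAZ (subsetIr _ _).
Qed.

Let sNG : N \subset G.
Proof. exact: subsetIl. Qed.

Let sEN : E \subset N.
Proof.
rewrite subsetI sEG; apply/subsetP => e Ee.
by apply/cent1P; apply: (centsP cEE).
Qed.

Let proper_N : ~~ (G \subset N).
Proof.
apply: contra nza => sGN; rewrite -defZ; apply/centerP; split=> // x Gx.
by have /setIP[_ /cent1P] := subsetP sGN x Gx.
Qed.

(** The index counts the conjugates of [<[a]>], which are among the p nontrivial members of [S]; it
    is a power of p different from 1. *)
Let index_N : #|G : N| = p.
Proof.
have pI : p.-nat #|G : N| by rewrite (pnat_dvd (dvdn_indexg _ _)).
have [k oI] := p_natP pI.
have : #|G : N| <= p.
  rewrite NE -astab1JG -card_orbit -ltnS -oS (cardsD1 1%G S) setU11 add1n ltnS.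
  apply/subset_leq_card/subsetP => B /orbitP[x Gx <-]; apply/setD1P; split.
    rewrite -cardG_gt1 /= cardJg -orderE oa //.
  apply: (S_J (groupVr Gx)); have -> : ((<[a]> :^ x) :^ x^-1)%G = <[a]>%G.
    by apply/group_inj; rewrite /= conjsgK.
  apply/setU1P; right; apply/setD1P; split.
    by apply: contraNneq nza => /(congr1 val)/=; rewrite defZ => <-; apply: cycle_id.
  by rewrite p1ElemE // !inE cycle_subG Ea -orderE oa eqxx.
have : 1 < #|G : N| by rewrite indexg_gt1.
move=> gt1 leI; apply/eqP; rewrite eqn_leq leI /=.
by rewrite oI in gt1 *; case: k gt1 {oI} => // k _; rewrite expnS leq_pmulr ?expn_gt0 ?(ltnW p_gt1).
Qed.

(* The nontrivial subgroups of N / <[a]> all contain E / <[a]>. *)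
Let Ohm_NA : 'Ohm_1(N / <[a]>) = E / <[a]>.
Proof.
have pNA : p.-group (N / <[a]>) by apply: quotient_pgroup; apply: pgroupS pG.
have nAN : N \subset 'N(<[a]>) by rewrite NE subsetIr.
rewrite (OhmE 1 pNA) expn1; apply/eqP; rewrite eqEsubset gen_subG.
apply/andP; split; last first.
  apply: subset_trans (subset_gen _); apply/subsetP => _ /morphimP[e nAe Ee ->].
  apply/LdivP; split; first by rewrite mem_quotient // (subsetP sEN).
  have [_ /abelemP[//|_ expE] _] := pnElemP Ep2E.
  by rewrite -morphX // expE // morph1.
apply/subsetP => _ /LdivP[/morphimP[x nAx Nx ->] xp].
have [Ax | nAx'] := boolP (x \in <[a]>); first by rewrite /= coset_id // group1.
have Gx := subsetP sNG x Nx.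
have sAB : <[a]> \subset <[a]> <*> <[x]> := joing_subl _ _.
have Bx : x \in <[a]> <*> <[x]> by rewrite -cycle_subG joing_subr.
have sBG : (<[a]> <*> <[x]>)%G \subset G by rewrite join_subG !cycle_subG Ga.
have ltB : p < #|<[a]> <*> <[x]>|.
  rewrite -oa; apply: proper_card; rewrite properE sAB.
  by apply: contra nAx' => /subsetP; apply.
have SB : (<[a]> <*> <[x]>)%G \notin S.
  by apply: card_notin_S; rewrite neq_ltn ?ltB ?(ltn_trans p_gt1 ltB) orbT.
have sZB := center_sub_notin_S sBG SB.
(* The join contains the center and [a], hence [E]; as [x ^+ p] lies in [<[a]>], its order is at
   most p^2. *)
rewrite mem_quotient //; suffices -> : E = (<[a]> <*> <[x]>)%G by [].
apply/group_inj/eqP; rewrite eqEcard join_subG -{1}defZ sZB sAB oE /=.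
have nAX : <[x]> \subset 'N(<[a]>) by rewrite cycle_subG.
rewrite -(Lagrange sAB) -orderE oa -card_quotient ?join_subG ?normG //.
rewrite quotientYidl // quotient_cycle // -orderE leq_pmul2l ?(ltnW p_gt1) //.
by rewrite dvdn_leq ?(ltnW p_gt1) // order_dvdn; apply/eqP.
Qed.

Let card_Ohm_NA : #|'Ohm_1(N / <[a]>)| = p.
Proof.
rewrite Ohm_NA card_quotient; last by rewrite (subset_trans sEN) // NE subsetIr.
rewrite -divgS ?cycle_subG // oE -orderE oa.
exact: (mulnK p (ltnW p_gt1)).
Qed.

Let NA_extremal :
  cyclic (N / <[a]>) || (p == 2) && (extremal_class (N / <[a]>) == Quaternion).
Proof.
have pNA : p.-group (N / <[a]>) by apply: quotient_pgroup; apply: pgroupS pG.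
apply/(prime_Ohm1P pNA) => //.
apply: contraTneq p_gt1 => NA1; rewrite -card_Ohm_NA.
by have /eqP := NA1; rewrite -Ohm1_eq1 => /eqP->; rewrite cards1.
Qed.

Let cyclic_NA : cyclic (N / <[a]>) -> N = E /\ #|G| = (p ^ 3)%N.
Proof.
move=> cycNA; have sAZ : <[a]> \subset 'Z(N).
  rewrite cycle_subG; apply/centerP; split; first by rewrite (subsetP sEN).
  by move=> x /setIP[_ /cent1P].
have cNN := cyclic_factor_abelian sAZ cycNA.
have oG : #|G| = (#|N| * p)%N by rewrite -index_N Lagrange.
have := cd_measure_le_max sNG; rewrite center_cd oG => le.
have leN : #|N| * #|N| <= p * (#|N| * p).
  apply: leq_trans le; rewrite leq_mul2l; apply/orP; right.
  by apply: subset_leq_card; rewrite subsetI sNG.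
have {}leN : #|N| <= p ^ 2 by rewrite mulnCA leq_pmul2l in leN.
have eNE : N = E by apply/group_inj/esym/eqP; rewrite eqEcard sEN oE.
split; first exact: eNE.
by rewrite eNE oE -expnSr.
Qed.

(* Otherwise x ^+ 2 lies in <[z]> because x moves a, and one of x and x * a is
   an involution outside E. *)
Let sqr_notin_E x : p = 2 -> x \in G -> x \notin N -> x ^+ 2 \notin E.
Proof.
move=> p2 Gx nNx; apply/negP => Ex2.
have nEx : x \notin E by apply: contra nNx => /(subsetP sEN).
have z2 : z * z = 1 by rewrite -expg2 -p2 -oz expg_order.
have a2 : a * a = 1 by rewrite -expg2 -p2 -oa expg_order.
have cyc2 (u v : gT) : #[u] = p -> v \in <[u]> -> v = 1 \/ v = u.
  rewrite p2 => ou /cyclePmin[i]; rewrite ou; case: i => [|[|i]] // _ ->; first by left.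
  by right; rewrite expg1.
have E4 e : e \in E -> [\/ e = 1, e = z, e = a | e = z * a].
  rewrite /= cent_joinEr; last first.
    rewrite cent_cycle cycle_subG; apply/cent1P.
    by have /centerP[_ /(_ a Ga)/commute_sym] := Zz.
  case/mulsgP=> u v /(cyc2 _ _ oz)[->|->] /(cyc2 _ _ oa)[->|->] ->;
    rewrite ?mul1g ?mulg1; by [constructor 1 | constructor 2 | constructor 3 | constructor 4].
have czx : commute z x by have /centerP[_ /(_ x Gx)] := Zz.
have nax : ~ commute a x.
  by move=> cax; case/negP: nNx; rewrite inE Gx; apply/cent1P.
have Eax : a ^ x \in E.
  apply: order_p_in_E; first exact: groupJ.
  by rewrite -conjXg -oa expg_order conj1g.
(* Among the four elements of [E], 1 and [z] are excluded by injectivity of conjugation, and [a]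
   because [x] does not commute with it. *)
have ax : a ^ x = z * a.
  case: (E4 _ Eax) => // e.
  - case/negP: nza; suffices -> : a = 1 by apply: group1.
    by apply/eqP; rewrite -(conjg_eq1 a x) e.
  - case/negP: nza; suffices -> : a = z by apply: cycle_id.
    by apply: (conjg_inj x); rewrite e; apply/esym/conjg_fixP/commgP.
  by case: nax; apply/commgP/conjg_fixP.
have cx2 : commute (x ^+ 2) x by rewrite /commute -expgS -expgSr.
case: (E4 _ Ex2) => e.
- by case/negP: nEx; apply: order_p_in_E; rewrite ?p2.
- case/negP: nEx; rewrite -(groupMr x Ea); apply: order_p_in_E; first exact: groupM.
  rewrite p2 expgS expg1.
  have -> : x * a * (x * a) = x ^+ 2 * a ^ x * a by rewrite conjgE expgS expg1 !mulgA mulgK.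
  by rewrite e ax !mulgA z2 mul1g a2.
- by apply: nax; rewrite -e.
apply: nax; rewrite /commute; apply: (mulgI z).
by rewrite mulgA -e cx2 e !mulgA czx.
Qed.

(* Since h generates a normal subgroup or a member of the lattice, either it is
   conjugate only to h and h^-1 or its centraliser has index 2. *)
Let commute_sqr_order4 h x : p = 2 -> h \in G -> #[h] = 4 -> x \in G ->
  commute h (x ^+ 2).
Proof.
move=> p2 Gh oh Gx; have sHG : <[h]>%G \subset G by rewrite cycle_subG.
have SH : <[h]>%G \notin S by apply: card_notin_S; rewrite -orderE oh ?p2.
have [cdH | ncdH] := boolP (<[h]>%G \in CD).
  have sCG : 'C_G[h] \subset G := subsetIl _ _.
  have iC : #|G : 'C_G[h]| = 2.
    have := cd_lattice_measure cdH.
    rewrite center_cd /cd_measure /= -orderE oh cent_cycle p2 -(Lagrange sCG).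
    have := cardG_gt0 'C_G[h]; rewrite /=.
    move: #|'C_G[h]| #|G : _| => c i; clear; nia.
  have nC : 'C_G[h]%G <| G by apply: index2_normal.
  have := expg_index_normal nC Gx; rewrite iC => /setIP[_ /cent1P].
  exact: commute_sym.
have nH := not_cd_normal sHG ncdH SH.
have Hhx : h ^ x \in <[h]>.
  by rewrite memJ_norm ?cycle_id // (subsetP (normal_norm nH)).
have [i lti hx] := cyclePmin Hhx; rewrite oh in lti.
(* With [h ^ x = h ^+ i], conjugation by [x ^+ 2] raises [h] to the power i * i. As [h ^ x] has
   order 4, i is odd, and i * i is 1 modulo 4. *)
apply/commgP/conjg_fixP; rewrite expgS expg1 conjgM hx conjXg hx -expgM.
case: i lti hx => [|[|[|[|i]]]] // _ hx.
- by have := orderJ h x; rewrite hx order1 oh.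
- have := orderJ h x; rewrite hx oh orderXdiv oh //.
by rewrite -(expg_mod_order h) oh.
Qed.

(** For p = 2 take [x] outside [N]; then [x ^+ 2] is in [N]. If the quotient by [<[a]>] is cyclic,
    [N = E]. If it is quaternion, preimages of its elements of order 4 have order 4 and commute with
    [x ^+ 2]; with [<[a]>] they generate [N], so [x ^+ 2] maps into the center of the quotient,
    which is the image of [E]. Both contradict [sqr_notin_E]. *)
Let p_neq2 : p != 2.
Proof.
apply/eqP => p2.
have [x Gx nNx] : exists2 x, x \in G & x \notin N by apply/subsetPn.
have nNG : N <| G by apply: index2_normal; rewrite ?index_N.
have Nx2 : x ^+ 2 \in N by rewrite -p2 -index_N expg_index_normal.
case/negP: (sqr_notin_E p2 Gx nNx); have := NA_extremal.
case/orP=> [/cyclic_NA[<-] // | /andP[_ /eqP quatNA]].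
have nAN : N \subset 'N(<[a]>) by rewrite NE subsetIr.
have sAN : <[a]> \subset N by rewrite cycle_subG (subsetP sEN).
have sAE : <[a]> \subset E by rewrite cycle_subG.
have sAC : <[a]> \subset 'C_N[x ^+ 2].
  by rewrite cycle_subG inE (subsetP sEN) //= cent1C; case/setIP: Nx2.
have eC : ('C_N[x ^+ 2] / <[a]>)%G :=: (N / <[a]>)%G.
  apply: (quaternion_order4_gen quatNA); first by rewrite quotientS ?subsetIl.
  move=> _ /morphimP[t nAt Nt ->] ot; apply: mem_quotient.
  have Gt := subsetP sNG t Nt.
  have nAt2 : t ^+ 2 \notin <[a]>.
    apply/negP => At2; have : #[coset <[a]> t] %| 2.
      by rewrite order_dvdn -morphX //= coset_id.
    by rewrite ot.
  have At4 : t ^+ 4 \in <[a]>.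
    by apply: coset_idr; [apply: groupX | rewrite morphX // -ot expg_order].
  have t2 : t ^+ 2 != 1 by apply: contraNneq nAt2 => ->; apply: group1.
  have sTG : <[t]>%G \subset G by rewrite cycle_subG.
  have St : <[t]>%G \notin S.
    apply: card_notin_S; rewrite -orderE.
      by apply: contraNneq t2 => /eqP; rewrite order_eq1 => /eqP->; rewrite expg1n.
    by apply: contraNneq t2; rewrite p2 => <-; rewrite expg_order.
  have sZt := center_sub_notin_S sTG St; rewrite defZ in sZt.
  (* Otherwise [t ^+ 4] generates [<[a]>], and the cyclic group [<[t]>] contains two subgroups of
     order p, [<[z]>] and [<[a]>]. *)
  have t4 : t ^+ 4 = 1.
    apply: contraNeq nza => nt4.
    have sTA : <[t ^+ 4]> = <[a]>.
      apply/eqP; rewrite eqEcard cycle_subG At4 -!orderE oa.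
      have := order_dvdG At4; rewrite -orderE oa => dp.
      have nt : #[t ^+ 4] != 1%N by rewrite order_eq1.
      by rewrite /= (elimT (prime_nt_dvdP p_pr nt) dp).
    have eza : <[z]>%G = <[a]>%G.
      apply/eqP; rewrite -val_eqE /= (eq_subG_cyclic (cycle_cyclic t)) //.
        by rewrite -!orderE oz oa.
      by rewrite /= -sTA cycleX.
    by have /= -> := congr1 val eza; apply: cycle_id.
  have ot4 : #[t] = 4.
    have : #[t] %| 2 ^ 2 by rewrite order_dvdn t4.
    case/(dvdn_pfactor _ 2 (isT : prime 2)) => -[|[|[|i]]] // _ o.
      by case/eqP: t2; apply/eqP; rewrite -order_dvdn o.
    by case/eqP: t2; apply/eqP; rewrite -order_dvdn o.
  by apply/setIP; split=> //; apply/cent1P; apply: commute_sqr_order4.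
have sNC : N \subset 'C_N[x ^+ 2].
  rewrite -(quotientSGK nAN sAC).
  by have /= -> := eC.
have cx2 : <[x ^+ 2]> \subset 'C(N).
  by rewrite cycle_subG -sub_cent1 (subset_trans sNC) ?subsetIr.
have ZNA : 'Z(N / <[a]>) = E / <[a]>.
  have /quaternion_classP[n n_gt2 isoNA] := quatNA.
  have [[u v] gen _] := generators_quaternion n_gt2 isoNA.
  have [_ _ [-> _ _ [<- _] _] _ _] := quaternion_structure n_gt2 gen isoNA.
  exact: Ohm_NA.
have nAx2 : <[x ^+ 2]> \subset 'N(<[a]>) by rewrite cycle_subG (subsetP nAN).
rewrite -cycle_subG -(quotientSGK nAx2 sAE) -ZNA subsetI quotientS ?cycle_subG //.
exact: quotient_cents.
Qed.

Lemma order_p_center_27 : [/\ p = 3, #|G| = 27, delta_cd G = 4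
  & exists2 x, x \in G & #[x] = 9].
Proof.
have p3 : p = 3 by move: p_gt1 p_neq2 le_p3; clear; lia.
have := NA_extremal; rewrite (negPf p_neq2) orbF => /cyclic_NA[eNE oG].
have oG27 : #|G| = 27 by rewrite oG p3.
split=> //.
  by apply/eqP; rewrite eqn_leq -ltnS lt5 -[4]/(3.+1) -p3 -oS card_le_delta_cd.
(* Since [N = E] contains all elements of order dividing 3 and [G] is not cyclic, any element
   outside [N] has order 9. *)
have [x Gx nNx] : exists2 x, x \in G & x \notin N by apply/subsetPn.
exists x => //; have := order_dvdG Gx; rewrite oG p3.
case/(dvdn_pfactor _ 3 (isT : prime 3)) => -[|[|[|[|i]]]] // _ ox.
- case/negP: nNx; rewrite eNE; apply: order_p_in_E => //.
  by rewrite p3; apply/eqP; rewrite -order_dvdn ox.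
- case/negP: nNx; rewrite eNE; apply: order_p_in_E => //.
  by rewrite p3; apply/eqP; rewrite -order_dvdn ox.
case/negP: nabG; have <- : <[x]> = G; last exact: cycle_abelian.
by apply/eqP; rewrite eqEcard cycle_subG Gx -orderE ox oG27.
Qed.

End PrimeCenter.

(** * Identification of the group of order 27 and assembly of the cases *)

Lemma extraspecial_27_exp_9 (gT : finGroupType) (G : {group gT}) x :
  #|G| = 27 -> ~~ abelian G -> x \in G -> #[x] = 9 -> is_extraspecial_27_exp_9 G.
Proof.
move=> oG nabG Gx ox; have pG : 3.-group G by rewrite /pgroup oG.
have sXG : <[x]> \subset G by rewrite cycle_subG.
have iX : #|G : <[x]>| = 3 by rewrite -divgS // oG -orderE ox.
have := maximal_cycle_extremal pG nabG (cycle_cyclic x) sXG iX.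
rewrite orbF => /eqP/modular_group_classP[p p_pr [n n_gt isoG]].
have n_gt2 : 2 < n by apply: leq_trans n_gt; rewrite leq_addl.
have := card_isog isoG; rewrite card_modular_group // oG => o27.
have p3 : p = 3.
  have : p %| 3 ^ 3 by rewrite -[(3 ^ 3)%N]/27 o27 dvdn_exp // (ltnW (ltnW n_gt2)).
  by rewrite Euclid_dvdX // dvdn_prime2 // => /andP[/eqP].
have n3 : n = 3.
  by apply/eqP; rewrite -(eqn_exp2l n 3 (isT : 1 < 3)) -{1}p3 -o27.
rewrite p3 n3 in isoG; apply: isoGrp_trans isoG _.
(* For p = n = 3 the exponents p^(n-1), p and p^(n-2) + 1 of the modular presentation are 9, 3 and
   4. *)
exact: (Grp_modular_group (isT : prime 3) (isT : 2 < 3)).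
Qed.

Lemma delta_nonabelian_pgroup (gT : finGroupType) (p : nat) (G : {group gT}) :
  p.-group G -> ~~ abelian G -> delta_cd G < 5 ->
  delta_cd G < 3 \/ delta_cd G = 4 /\ is_extraspecial_27_exp_9 G.
Proof.
move=> pG nabG lt5.
have ntG : G :!=: 1 by apply: contraNneq nabG => ->; apply: abelian1.
have ntZ : 'Z(G) != 1.
  by apply: contraNneq ntG => /(trivg_center_pgroup pG)->.
have [p_pr pZ _] := pgroup_pdiv (pgroupS (center_sub G) pG) ntZ.
have [z Zz oz] := Cauchy p_pr pZ.
have [/eqP/(prime_Ohm1P pG ntG) | nO] := boolP (#|'Ohm_1(G)| == p).
  case/orP=> [/cyclic_abelian cGG | /andP[/eqP p2 /eqP quatG]].
    by rewrite cGG in nabG.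
  rewrite p2 in pG; case: (delta_quaternion pG quatG) => [|ge5]; first by left.
  by rewrite leqNgt lt5 in ge5.
have [a [Ga oa nza]] := p2Elem_exists pG Zz oz nO.
have Ep2E := generators_p2Elem p_pr Zz oz Ga oa nza.
have [/eqP oZ | noZ] := boolP (#|'Z(G)| == p); last first.
  by have := delta_center_not_prime pG nabG noZ Ep2E; rewrite leqNgt lt5.
have defZ : 'Z(G) = <[z]>.
  by apply/esym/eqP; rewrite eqEcard cycle_subG Zz -orderE oz oZ leqnn.
have [p3 oG d4 [x Gx ox]] := order_p_center_27 pG nabG defZ oz Ga oa nza lt5.
by right; split=> //; apply: extraspecial_27_exp_9 Gx ox.
Qed.

End ChermakDelgado.


Theorem theorem3 (gT : finGroupType) (G : {group gT}) :
  delta_cd G < 5 ->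
  [\/ delta_cd G < 3,
      delta_cd G = 3 /\
        cyclic G /\
        ((exists p q : nat, prime p /\ prime q /\ #|G| = p * q) \/
         (exists p : nat, prime p /\ #|G| = p ^ 3))
    | delta_cd G = 4 /\
        [\/ cyclic G /\ (exists p : nat, prime p /\ #|G| = p ^ 4),
            (G \isog [set: ('Z_2 * 'Z_2)%type])%g
          | is_extraspecial_27_exp_9 G] ].
Proof.
move=> lt5; have [cGG | nabG] := boolP (abelian G).
  have [cycG | ncG] := boolP (cyclic G); last first.
    have [d4 isoG] := delta_abelian_noncyclic cGG ncG lt5.
    by constructor 3; split=> //; constructor 2.
  have dG : (delta_cd G).+1 = size (divisors #|G|).
    rewrite delta_abelian // -card_subgroups_cyclic //.
    by rewrite prednK // (cardD1 G) inE subxx.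
  have le5 : size (divisors #|G|) <= 5 by rewrite -dG.
  case: (few_divisors (cardG_gt0 G) le5); rewrite -dG.
  - by constructor 1.
  - case=> -[d3] oG; constructor 2; split=> //; split=> //.
    by case: oG => [[p [q [p_pr q_pr oG]]] | [p p_pr oG]]; [left; exists p, q | right; exists p].
  case=> -[d4] [p p_pr oG]; constructor 3; split=> //; constructor 1; split=> //.
  by exists p.
have [nilG | nnG] := boolP (nilpotent G); last first.
  by have := delta_nonnilpotent nnG; rewrite leqNgt lt5.
(* Bounding p by |G| makes the case distinction boolean; it loses nothing, since the prime of a
   nontrivial p-group divides its order. *)
have [/existsP[p pG] | npG] := boolP [exists p : 'I_#|G|.+1, (p.-group G)%g].
  case: (delta_nonabelian_pgroup pG nabG lt5) => [lt3 | [d4 exG]].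
    by constructor 1.
  by constructor 3; split=> //; constructor 3.
have ncG : ~~ cyclic G by apply: contra nabG; apply: cyclic_abelian.
suffices /(delta_nilpotent_non_pgroup nilG ncG) : forall p : nat, ~~ (p.-group G)%g.
  by rewrite leqNgt lt5.
move=> p; apply: contra npG => pG.
have ntG : (G : {set gT}) != 1%g by apply: contraNneq nabG => ->; apply: abelian1.
have [p_pr pdG _] := pgroup_pdiv pG ntG.
have ltp : p < #|G|.+1 by rewrite ltnS dvdn_leq.
by apply/existsP; exists (Ordinal ltp).
Qed.
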